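(* Let $p$ be an odd prime and write $p-1 = 2^{e} r$ with $e \ge 1$ and $r$ odd. For every positive divisor $m$ of $r$ define, by downward recursion over the divisors of $r$ (ordered by divisibility), \[ S(r) = 0, \qquad S(m) = \sum_{\substack{n \mid r,\ m \mid n,\\ m < n}} k_n \cdot \frac{p-1}{n} \quad (m \mid r,\ m<r), \] \[ k_m = \frac{2^{\frac{p-1}{2m}} - S(m)}{\frac{p-1}{m}} \quad (m \mid r). \] (In the paper's notation $\varphi_p(m) = \big(k_m, \tfrac{p-1}{m}\big)$, and $\mathrm{pr}_1(\varphi_p(m)) = k_m$.) Then the number of isomorphism classes of vertex-transitive tournaments on $p$ vertices equals \[ \sum_{\substack{m \mid r,\\ 1 \le m \le r}} k_m . \]
   Context: A tournament is a (finite, loopless) directed graph obtained by assigning a direction to each edge of an undirected complete graph, i.e. for any two distinct vertices $v,w$ exactly one of the arcs $v\to w$, $w \to v$ is present. A digraph $G$ is vertex-transitive if its automorphism group $\mathrm{Aut}(G)$ acts transitively on its vertex set. Two tournaments are isomorphic if there is a bijection between their vertex sets preserving arcs in both directions. *)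

(* Defs.v *)
From mathcomp Require Import all_boot all_order all_algebra all_fingroup.

Set Implicit Arguments.
Unset Strict Implicit.
Unset Printing Implicit Defensive.

Import GRing.Theory.
Local Open Scope ring_scope.

Section Digraphs.
Variable T : finType.

(* A digraph with vertex set T is the set of its arcs. *)
Definition digraph := {set T * T}.

Definition loopless (G : digraph) : bool := [forall v, (v, v) \notin G].

Definition tournament (G : digraph) : bool :=
  loopless G &&
  [forall v, forall w, (v != w) ==> (((v, w) \in G) (+) ((w, v) \in G))].

Definition is_isomorphism (G H : digraph) (s : {perm T}) : bool :=
  [forall v, forall w, ((v, w) \in G) == ((s v, s w) \in H)].

(* Both digraphs have the same vertex type, so the bijections between their
   vertex sets are the permutations of T. *)
Definition isomorphic (G H : digraph) : bool :=
  [exists s : {perm T}, is_isomorphism G H s].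

Definition Aut_digraph (G : digraph) : {set {perm T}} :=
  [set s | is_isomorphism G G s].

Definition vertex_transitive (G : digraph) : bool :=
  [transitive Aut_digraph G, on [set: T] | 'P].

Lemma is_isomorphismP (G H : digraph) (s : {perm T}) :
  reflect (forall v w, ((v, w) \in G) = ((s v, s w) \in H))
          (is_isomorphism G H s).
Proof.
apply: (iffP forallP) => [h v w|h v]; first exact/eqP/(forallP (h v)).
by apply/forallP=> w; apply/eqP.
Qed.

Lemma Aut_digraph_group_set (G : digraph) : group_set (Aut_digraph G).
Proof.
apply/group_setP; split=> [|s t].
  by rewrite inE; apply/is_isomorphismP=> v w; rewrite !perm1.
rewrite !inE => /is_isomorphismP hs /is_isomorphismP ht.
by apply/is_isomorphismP=> v w; rewrite !permM -ht -hs.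
Qed.

Canonical Aut_digraph_group (G : digraph) := Group (Aut_digraph_group_set G).

Lemma isomorphic_equiv : equivalence_rel isomorphic.
Proof.
have refl G : isomorphic G G.
  apply/existsP; exists 1%g.
  by apply/is_isomorphismP=> v w; rewrite !perm1.
have sym G H : isomorphic G H -> isomorphic H G.
  case/existsP=> s /is_isomorphismP hs; apply/existsP; exists s^-1%g.
  by apply/is_isomorphismP=> v w; rewrite hs !permKV.
have trans G H K : isomorphic G H -> isomorphic H K -> isomorphic G K.
  case/existsP=> s /is_isomorphismP hs /existsP[t /is_isomorphismP ht].
  apply/existsP; exists (s * t)%g.
  by apply/is_isomorphismP=> v w; rewrite hs ht !permM.
move=> G H K; split=> // GH.
by apply/idP/idP; apply: trans => //; apply: sym.
Qed.

Definition vt_tournaments : {set digraph} :=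
  [set G | tournament G && vertex_transitive G].

Definition vt_tournament_classes : {set {set digraph}} :=
  equivalence_partition isomorphic vt_tournaments.

End Digraphs.

Section Recursion.
Variables p r : nat.

Definition S_of (k : nat -> rat) (m : nat) : rat :=
  if m == r then 0 else
  \sum_(1 <= n < r.+1 | [&& n %| r, m %| n & m < n]%N)
     k n * (p.-1%:R / n%:R).

(* The division in the exponent is exact for m dividing r, since p - 1 is
   divisible by 2 r. *)
Definition k_of (S : rat) (m : nat) : rat :=
  (2 ^+ (p.-1 %/ (2 * m))%N - S) / (p.-1%:R / m%:R).

(* Recursion on a fuel argument: the value at m only uses the values at n with
   m < n <= r, so r - m + 1 steps suffice (see k_E). *)
Fixpoint k_fuel (fuel m : nat) : rat :=
  if fuel is fuel'.+1 then k_of (S_of (k_fuel fuel') m) m else 0.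

Definition k_ (m : nat) : rat := k_fuel (r - m).+1 m.

Definition S_ (m : nat) : rat := S_of k_ m.

Lemma eq_S_of k k' m :
  (forall n, (m < n <= r)%N -> k n = k' n) -> S_of k m = S_of k' m.
Proof.
move=> eqk; rewrite /S_of; case: ifP => // _.
rewrite [LHS]big_nat_cond [RHS]big_nat_cond; apply: eq_bigr => n.
by case/andP=> /andP[_ nr] /and3P[_ _ mn]; rewrite eqk // mn -ltnS.
Qed.

Lemma k_fuel_indep f g m :
  (r - m < f)%N -> (r - m < g)%N -> k_fuel f m = k_fuel g m.
Proof.
elim: f g m => [//|f IH] [//|g] m lef leg.
rewrite [LHS]/k_fuel -/k_fuel [RHS]/k_fuel -/k_fuel.
congr (k_of _ m); apply: eq_S_of => n /andP[mn nr].
have lt : (r - n < r - m)%N by rewrite ltn_sub2l // (leq_trans mn).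
by apply: IH; apply: (leq_trans lt); rewrite -ltnS.
Qed.

Lemma S_r : S_ r = 0.
Proof. by rewrite /S_ /S_of eqxx. Qed.

Lemma S_E m : (m < r)%N ->
  S_ m = \sum_(1 <= n < r.+1 | [&& n %| r, m %| n & m < n]%N)
            k_ n * (p.-1%:R / n%:R).
Proof. by move=> lt_mr; rewrite /S_ /S_of (ltn_eqF lt_mr). Qed.

Lemma k_E m : k_ m = (2 ^+ (p.-1 %/ (2 * m))%N - S_ m) / (p.-1%:R / m%:R).
Proof.
rewrite -/(k_of (S_ m) m) {1}/k_ [LHS]/k_fuel -/k_fuel.
congr (k_of _ m); apply: eq_S_of => n /andP[mn nr].
by apply: k_fuel_indep => //; rewrite ltn_sub2l // (leq_trans mn).
Qed.

End Recursion.

(* Main.v *)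
Require Import Defs.
From mathcomp Require Import all_boot all_order all_algebra all_fingroup.
From mathcomp Require Import all_solvable zify.

(* Let p be prime. A transitive permutation group on p points contains a
   p-cycle, and p divides p! exactly once, so by Sylow's theorem every
   vertex-transitive tournament is isomorphic to a circulant one on F_p, and an isomorphism of
   circulants can be corrected by an automorphism into one normalizing the
   translations, i.e. into an affine map. The isomorphism classes are therefore
   the orbits of the cyclic group F_p^* on its subsets C such that F_p^* is the
   disjoint union of C and -C. The stabilizer of such a C does not contain -1,
   hence has odd order n dividing r, and the sets C fixed by the subgroup of
   order m number 2^((p-1)/2m). Sorting these by the order n of their stabilizer
   gives the recursion, with k_n the number of orbits of length (p-1)/n. *)

Set Implicit Arguments.
Unset Strict Implicit.
Unset Printing Implicit Defensive.

Import GroupScope GRing.Theory Num.Theory.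

(** * Halving sets of a finite cyclic group with an involution *)

Section CyclicGroup.
Variables (gT : finGroupType) (g z : gT).
Hypotheses (genT : <[g]> = [set: gT]) (oz : #[z] = 2).

(** For [z] equal to -1 in F_p^* these are the connection sets of the circulant tournaments. *)
Definition halving_sets : {set {set gT}} :=
  [set C : {set gT} | [forall x, (x \in C) (+) (x * z \in C)]].

Lemma halving_setsP (C : {set gT}) :
  reflect (forall x, (x * z \in C) = (x \notin C)) (C \in halving_sets).
Proof.
rewrite inE; apply: (iffP forallP) => hC x.
  by have := hC x; case: (x \in C); case: (_ \in C).
by rewrite hC; case: (x \in C).
Qed.

Lemma order_generator : #[g] = #|[set: gT]|.
Proof. by rewrite /order genT. Qed.

Lemma expg_surj x : exists j, x = g ^+ j.
Proof. by apply/cycleP; rewrite genT inE. Qed.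

Lemma stab_rcosetP (C : {set gT}) a :
  reflect (forall x, (x * a \in C) = (x \in C)) (a \in 'C[C | 'Rs]).
Proof.
apply: (iffP astab1P) => /= [|Ca]; rewrite rcosetE; first move=> Ca x.
  by rewrite -{1}Ca mem_rcoset mulgK.
by apply/setP => x; rewrite mem_rcoset -Ca mulgKV.
Qed.

Lemma acts_halving_sets : [acts [set: gT], on halving_sets | 'Rs].
Proof.
have cG : abelian [set: gT] by rewrite -genT cycle_abelian.
apply/actsP => a _ C /=; rewrite rcosetE.
suff sub b D : D \in halving_sets -> D :* b \in halving_sets.
  by apply/idP/idP => [/(sub a^-1)|/(sub a)//]; rewrite -rcosetM mulgV rcoset1.
move=> /halving_setsP DP; apply/halving_setsP => x.
by rewrite !mem_rcoset -DP -!mulgA (centsP cG z _ b^-1) ?inE.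
Qed.

(** * Halving sets fixed by a given subgroup *)

Section FixedSets.
Variables (m t : nat).
Hypotheses (m_odd : odd m) (NE : #|[set: gT]| = (2 * m * t)%N).

(** A cyclic group has at most one involution, and [m * t] is half the group order. *)
Lemma involution_expg : z = g ^+ (m * t).
Proof.
have [j zE] := expg_surj z.
have : z ^+ 2 == 1 by rewrite -order_dvdn oz.
have : z != 1 by rewrite -order_gt1 oz.
rewrite zE -expgM -!order_dvdn order_generator NE => nd /dvdnP[q jq].
have jE : j = (q * (m * t))%N by lia.
rewrite jE; apply/eqP; rewrite eq_expg_mod_order order_generator NE.
have q_odd : odd q.
  apply/negP => /negP q_even; case/negP: nd; rewrite jE.
  apply/dvdnP; exists q./2.
  by rewrite -{1}(odd_double_half q) (negbTE q_even); lia.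
rewrite -(odd_double_half q) q_odd.
have -> : ((true + (q./2).*2) * (m * t) = q./2 * (2 * m * t) + m * t)%N by lia.
by rewrite modnMDl.
Qed.

Lemma exponent_gt0 : 0 < t.
Proof. by have := cardG_gt0 [set: gT]; rewrite NE muln_gt0 => /andP[]. Qed.

Definition fixed_halving_sets :=
  [set C in halving_sets | <[g ^+ (2 * t)]> \subset 'C[C | 'Rs]].

(** As [m] is odd, [m * t] is [t] plus a multiple of [2 * t]. On a set fixed by [g ^+ (2 * t)],
    multiplying by [g ^+ t] therefore acts like multiplying by [z], which flips membership. *)
Lemma fixed_halving_expg C j : C \in fixed_halving_sets ->
  (g ^+ j \in C) = odd (j %/ t) (+) (g ^+ (j %% t) \in C).
Proof.
rewrite inE cycle_subG => /andP[/halving_setsP CP hC].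
have step i : (g ^+ (i + t) \in C) = (g ^+ i \notin C).
  have /stab_rcosetP <- : (g ^+ (2 * t)) ^+ m./2 \in 'C[C | 'Rs].
    exact: groupX.
  rewrite -CP involution_expg -expgM -!expgD; congr (g ^+ _ \in C).
  by rewrite -{2}(odd_double_half m) m_odd; lia.
rewrite {1}(divn_eq j t); elim: (j %/ t) => [|q IH] //=.
by rewrite mulSn -addnA addnC step IH addNb.
Qed.

(* A halving set fixed by the subgroup of order m is determined by its trace on
   1, g, ..., g^(t-1), because multiplication by g^t complements it. *)
Lemma card_fixed_halving_sets : #|fixed_halving_sets| = (2 ^ t)%N.
Proof.
have t0 := exponent_gt0.
pose phi (C : {set gT}) := [set i : 'I_t | g ^+ i \in C].
have phi_inj : {in fixed_halving_sets &, injective phi}.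
  move=> C D CX DX /setP eqCD; apply/setP => x; have [j ->] := expg_surj x.
  rewrite (fixed_halving_expg _ CX) (fixed_halving_expg _ DX); congr (_ (+) _).
  by have := eqCD (Ordinal (ltn_pmod j t0)); rewrite !inE.
rewrite -(card_in_imset phi_inj) (_ : phi @: _ = powerset [set: 'I_t]).
  by rewrite card_powerset cardsT card_ord.
apply/setP => E; rewrite powersetT inE; apply/imsetP.
(* The forced indicator, on exponents, of a set with trace [E]: it flips at each shift by [t]. Its
   period [2 * t] divides the order of [g], so it depends only on [g ^+ j]. *)
pose f j := odd (j %/ t) (+) (Ordinal (ltn_pmod j t0) \in E).
have fD j : f (j + t)%N = ~~ f j.
  rewrite /f divnDr // divnn t0 addn1 /= addNb; congr (~~ (_ (+) (_ \in E))).
  by apply: val_inj => /=; rewrite modnDr.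
have f2t q j : f (j + q * (2 * t))%N = f j.
  elim: q => [|q IH]; first by rewrite addn0.
  rewrite -[RHS]IH -[RHS]negbK -!fD; congr f; lia.
have f_mod i j : i = j %[mod #[g]] -> f i = f j.
  move=> eq_ij; rewrite (divn_eq i #[g]) (divn_eq j #[g]) eq_ij.
  have fN q k : f (q * (2 * m * t) + k)%N = f k.
    by rewrite -(f2t (q * m)%N k); congr f; lia.
  by rewrite order_generator NE !fN.
pose C := [set x : gT | [exists j : 'I_#[g], (x == g ^+ j) && f j]].
have CE j : (g ^+ j \in C) = f j.
  rewrite inE; apply/existsP/idP => [[i /andP[eq_ij fi]]|fj].
    by rewrite eq_expg_mod_order in eq_ij; rewrite (f_mod _ _ (eqP eq_ij)).
  exists (Ordinal (ltn_pmod j (order_gt0 g))) => /=.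
  by rewrite expg_mod_order eqxx (f_mod _ j) ?modn_mod.
exists C; last first.
  apply/setP => i; rewrite inE CE /f divn_small //=.
  by congr (_ \in E); apply: val_inj; rewrite /= modn_small.
rewrite inE cycle_subG; apply/andP; split.
  apply/halving_setsP => x; have [j ->] := expg_surj x.
  rewrite involution_expg -expgD !CE -fD.
  rewrite -[RHS](f2t m./2); congr f.
  by rewrite -{1}(odd_double_half m) m_odd; lia.
apply/stab_rcosetP => x; have [j ->] := expg_surj x.
by rewrite -expgD !CE -(f2t 1%N j) mul1n.
Qed.

End FixedSets.

(** * Strata by stabilizer order, the recursion, and the number of orbits *)

Section Orbits.
Variables (p e r : nat).
Hypotheses (pE : p.-1 = #|[set: gT]|) (e_gt0 : 0 < e) (r_odd : odd r).
Hypothesis NE : #|[set: gT]| = (2 ^ e * r)%N.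

Let X := halving_sets.
Let stab_order (C : {set gT}) := #|'C[C | 'Rs]|.

(** A stabilizer of even order would contain the unique subgroup of order 2, generated by [z], but
    [z] sends [C] to its complement. *)
Lemma stab_order_dvd C : C \in X -> stab_order C %| r.
Proof.
move=> /halving_setsP CP.
have sGN : stab_order C %| 2 ^ e * r by rewrite -NE cardSg ?subsetT.
rewrite -(@Gauss_dvdr _ (2 ^ e)) // coprime_sym coprimeXl // coprime2n.
apply/negP => /negP; rewrite -dvdn2 -oz /stab_order.
have cycT : cyclic [set: gT] by apply/cyclicP; exists g.
rewrite (cardSg_cyclic cycT) ?subsetT // cycle_subG => /stab_rcosetP/(_ 1).
by rewrite CP; case: (1 \in C).
Qed.

Definition stratum n := [set C in X | stab_order C == n].

(** Double counting: by [stab_order_dvd] each halving set lies in exactly one stratum with index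
    dividing [r]. *)
Lemma sum_strata (P : pred nat) (f : nat -> rat) :
  (\sum_(1 <= n < r.+1 | (n %| r)%N && P n) f n * #|stratum n|%:R =
   \sum_(C in X | P (stab_order C)) f (stab_order C))%R.
Proof.
have r_gt0 : 0 < r by case: r r_odd.
transitivity (\sum_(1 <= n < r.+1 | (n %| r)%N && P n)
                \sum_(C in X | stab_order C == n) f n)%R.
  apply: eq_bigr => n _; rewrite sumr_const mulr_natr; congr (_ *+ _)%R.
  by apply: eq_card => C; rewrite [LHS]inE.
rewrite (exchange_big_dep (fun C => (C \in X) && P (stab_order C))) /=;
  last first.
  by move=> n C /andP[_ Pn] /andP[-> /eqP->].
apply: eq_bigr => C /andP[CX PC].
have dC := stab_order_dvd CX.
transitivity (\sum_(1 <= n < r.+1 | ((n %| r)%N && P n) && (n == stab_order C))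
                f n)%R.
  by apply: eq_bigl => n; rewrite CX [n == _]eq_sym.
by rewrite big_nat1_cond_eq cardG_gt0 ltnS dvdn_leq // dC PC.
Qed.

(** In a cyclic group, [m] divides the order of the stabilizer exactly when the stabilizer contains
    the subgroup of order [m]. The sum thus counts [fixed_halving_sets]. *)
Lemma sum_strata_above m : m %| r ->
  (\sum_(1 <= n < r.+1 | (n %| r)%N && (m %| n)%N) #|stratum n|%:R =
   2 ^+ (p.-1 %/ (2 * m))%N :> rat)%R.
Proof.
move=> m_dvd; have r_gt0 : 0 < r by case: r r_odd.
have m_gt0 : 0 < m := dvdn_gt0 r_gt0 m_dvd.
have m_odd : odd m := dvdn_odd m_dvd r_odd.
set t := (_ %/ _)%N.
have NEt : #|[set: gT]| = (2 * m * t)%N.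
  rewrite /t pE mulnC divnK // NE -(prednK e_gt0) expnS -mulnA.
  by rewrite dvdn_mul // dvdn_mull.
rewrite -natrX -(card_fixed_halving_sets m_odd NEt).
under eq_bigr do rewrite -[_%:R%R]mul1r.
rewrite (sum_strata _ (fun=> 1%R)) sumr_const; congr (_%:R)%R.
apply: eq_card => C; rewrite [RHS]inE -[LHS]/(_ && _); congr (_ && _).
have cycT : cyclic [set: gT] by apply/cyclicP; exists g.
have t0 := exponent_gt0 NEt.
have <- : #|<[g ^+ (2 * t)]>| = m.
  rewrite -[LHS]/(#[_]) orderXdiv order_generator NEt.
    by rewrite (_ : 2 * m * t = m * (2 * t))%N ?mulnK //; lia.
  by apply/dvdnP; exists m; lia.
by rewrite (cardSg_cyclic cycT) ?subsetT.
Qed.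

(** Orbits in [stratum m] have length [#|[set: gT]|] divided by [m], so the right side is their
    number. The induction descends from [r], through the measure [r - m]. *)
Lemma k_stratum m : m %| r ->
  (k_ p r m = #|stratum m|%:R * (m%:R / #|[set: gT]|%:R))%R.
Proof.
have [n] := ubnP (r - m)%N; elim: n m => // n IH m lt_n m_dvd.
have r_gt0 : 0 < r by case: r r_odd.
have m_gt0 : 0 < m := dvdn_gt0 r_gt0 m_dvd.
have N0 : (#|[set: gT]|%:R != 0 :> rat)%R by rewrite pnatr_eq0 -lt0n cardG_gt0.
have nz k : 0 < k -> (k%:R != 0 :> rat)%R by rewrite pnatr_eq0 -lt0n.
(* By induction each term of the recursion is the size of a stratum. At [m = r] the value 0 set by
   definition agrees with an empty sum. *)
have SE : (S_ p r m = \sum_(1 <= k < r.+1 | [&& k %| r, m %| k & m < k]%N)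
                        #|stratum k|%:R)%R.
  have [lt_mr|le_rm] := ltnP m r; last first.
    have mr : m = r by apply/eqP; rewrite eqn_leq le_rm dvdn_leq.
    rewrite {1}mr S_r big_nat_cond big_pred0 // => k.
    by apply/negP => /andP[/andP[_ kr] /and3P[_ _ mk]]; lia.
  rewrite S_E // [LHS]big_nat_cond [RHS]big_nat_cond; apply: eq_bigr => k.
  case/andP=> /andP[k_gt0 kr] /and3P[k_dvd _ mk].
  rewrite IH //; last by lia.
  rewrite pE -mulrA [(_ / _ * _)%R]mulrA mulrVK ?unitfE // divff ?mulr1 //.
  exact: nz.
have restE : (2 ^+ (p.-1 %/ (2 * m))%N - S_ p r m = #|stratum m|%:R :> rat)%R.
  rewrite -(sum_strata_above m_dvd) SE (bigID (fun k => k == m)) /=.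
  rewrite big_nat1_cond_eq m_gt0 ltnS dvdn_leq // m_dvd dvdnn /=.
  apply/eqP; rewrite subr_eq eq_sym; apply/eqP; congr (_ + _)%R.
  apply: eq_bigl => k; rewrite -andbA; apply: andb_id2l => k_dvd.
  apply: andb_id2l => mk.
  by rewrite ltn_neqAle eq_sym (dvdn_leq _ mk) ?(dvdn_gt0 r_gt0 k_dvd) // andbT.
by rewrite k_E restE pE invf_div.
Qed.

(** Burnside's count: pairs of a group element and a halving set fixed by it, counted by sets, give
    the sum of the stabilizer orders, which is the group order times the number of orbits. *)
Lemma card_halving_orbits :
  (#|orbit 'Rs [set: gT] @: X|%:R
     = \sum_(1 <= m < r.+1 | (m %| r)%N) k_ p r m)%R.
Proof.
have N0 : (#|[set: gT]|%:R != 0 :> rat)%R by rewrite pnatr_eq0 -lt0n cardG_gt0.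
transitivity (\sum_(1 <= m < r.+1 | (m %| r)%N && predT m)
                 (m%:R / #|[set: gT]|%:R) * #|stratum m|%:R : rat)%R;
  last first.
  rewrite [RHS]big_mkcond [LHS]big_mkcond; apply: eq_bigr => m _.
  by rewrite andbT; case: ifP => // m_dvd; rewrite k_stratum // mulrC.
rewrite (sum_strata _ (fun n => n%:R / _)%R) -mulr_suml -natr_sum.
apply: (canRL (mulfK N0)); rewrite -natrM -(Frobenius_Cauchy acts_halving_sets).
congr (_%:R)%R.
under eq_bigr do rewrite -sum1_card.
rewrite (exchange_big_dep (mem X)) /=; last by move=> a C _ /setIP[].
apply: eq_big => [C|C CX]; first by rewrite andbT.
rewrite sum1_card; apply: eq_card => a.
rewrite -[LHS]/(_ && _) [_ \in _ :&: _]in_setI CX in_setT !andTb.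
by apply/afix1P/astab1P.
Qed.

End Orbits.
End CyclicGroup.

(** * Comparing the sizes of two images of one set *)

Lemma leq_card_imset_fibers (aT rT rT' : finType) (f : aT -> rT) (g : aT -> rT')
    (A : {set aT}) :
  {in A &, forall x y, f x = f y -> g x = g y} -> #|g @: A| <= #|f @: A|.
Proof.
move=> fg; have [->|[x0 Ax0]] := set_0Vmem A; first by rewrite !imset0 cards0.
(* [h] is the map through which [g] factors on [A]; the default [x0] is never reached on
   [f @: A]. *)
pose h b := g (odflt x0 [pick x in A | f x == b]).
suff -> : g @: A = h @: (f @: A) by apply: leq_imset_card.
rewrite -imset_comp; apply: eq_in_imset => x Ax; rewrite /h /=.
by case: pickP => [y /andP[Ay /eqP/esym]|/(_ x)]; [apply: fg | rewrite Ax eqxx].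
Qed.

Lemma card_imset_fibers (aT rT rT' : finType) (f : aT -> rT) (g : aT -> rT')
    (A : {set aT}) :
  {in A &, forall x y, f x = f y <-> g x = g y} -> #|g @: A| = #|f @: A|.
Proof.
move=> fg; apply/eqP; rewrite eqn_leq.
by rewrite !leq_card_imset_fibers // => x y Ax Ay; apply fg.
Qed.

(** * Transport of digraphs and conjugacy of cycles of prime length *)

Section Isomorphisms.
Variable T : finType.
Implicit Types (G H : digraph T) (s : {perm T}).

Lemma isomorphism_tournament G H s :
  is_isomorphism G H s -> tournament G -> tournament H.
Proof.
move=> /is_isomorphismP GH /andP[/forallP Gl /forallP Gt].
apply/andP; split; first by apply/forallP => v; rewrite -(permKV s v) -GH.
apply/forallP => v; apply/forallP => w; apply/implyP.
rewrite -(permKV s v) -(permKV s w) -!GH (inj_eq perm_inj).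
exact: implyP (forallP (Gt _) _).
Qed.

Lemma isomorphism_conj_Aut G H s a :
  is_isomorphism G H s -> a \in Aut_digraph G -> a ^ s \in Aut_digraph H.
Proof.
move=> /is_isomorphismP GH; rewrite !inE => /is_isomorphismP aG.
apply/is_isomorphismP => v w; rewrite -(permKV s v) -(permKV s w).
by rewrite !permJ -!GH -aG.
Qed.

Definition digraph_image G s : digraph T :=
  [set e | (s^-1 e.1, s^-1 e.2) \in G].

Lemma digraph_imageP G s : is_isomorphism G (digraph_image G s) s.
Proof. by apply/is_isomorphismP => v w; rewrite inE /= !permK. Qed.

Lemma Sylow_cycle_prime (A : {group {perm T}}) x :
  prime #|T| -> #[x] = #|T| -> x \in A -> #|T|.-Sylow(A) <[x]>.
Proof.
set p := #|T| => p_pr ox xA; rewrite pHallE cycle_subG xA /= -[#|_|]/(#[x]) ox.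
rewrite eqn_dvd; apply/andP; split.
  rewrite -{1}(part_pnat_id (pnat_id p_pr)) partn_dvd ?cardG_gt0 //.
  by rewrite -ox order_dvdG.
have pE : p = ((p`!)`_p)%N.
  (* In Legendre's formula for the exponent of p in p! only the first term survives, since p^k
     exceeds p for k > 1. *)
  rewrite p_part logn_fact // big_ltn ?ltnS ?prime_gt0 // expn1 divnn.
  rewrite prime_gt0 //.
  rewrite big_nat_cond big1 ?addn0 ?expn1 // => k /andP[/andP[k1 _] _].
  have := ltn_exp2l 1 k (prime_gt1 p_pr); rewrite expn1 k1.
  exact: divn_small.
by rewrite [X in _ %| X]pE partn_dvd ?fact_gt0 // -card_Sym cardSg ?subsetT.
Qed.

(** Both cycles generate Sylow subgroups of [A]. This serves once with the full symmetric group and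
    once with the automorphism group of a circulant. *)
Lemma cycle_conj_prime (A : {group {perm T}}) x y :
    prime #|T| -> #[x] = #|T| -> #[y] = #|T| -> x \in A -> y \in A ->
  exists2 h, h \in A & <[y]> = <[x ^ h]>.
Proof.
move=> p_pr ox oy xA yA.
have [h hA e] := Sylow_trans (Sylow_cycle_prime p_pr ox xA)
                             (Sylow_cycle_prime p_pr oy yA).
by exists h; rewrite // cycleJ.
Qed.

End Isomorphisms.

(** * Circulant tournaments over a field of prime order *)

Section Circulants.
Variable F : finFieldType.
Hypothesis p_pr : prime #|F|.

Lemma pchar_prime_card : #|F| \in [pchar F]%R.
Proof.
rewrite inE p_pr /=; apply/eqP.
by have := expg_cardG (in_setT (1%R : F)); rewrite cardsT FinRing.zmodXgE.
Qed.

(** The multiples of 1 by 0, ..., p-1 are distinct in characteristic p, and there are as many of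
    them as elements of [F]. Hence translation by 1 generates all translations. *)
Lemma natr_surj (x : F) : exists n, x = n%:R%R.
Proof.
have nat_inj : injective (fun i : 'I_#|F| => i%:R%R : F).
  suff le_inj (i j : 'I_#|F|) : i <= j -> i%:R%R = j%:R%R :> F -> i = j.
    by move=> i j eq_ij; have [/le_inj|/ltnW/le_inj->] := leqP i j; first apply.
  move=> le_ij /esym/eqP; rewrite -subr_eq0 -natrB //.
  rewrite -(dvdn_pcharf pchar_prime_card).
  move=> dvd_ji; apply: val_inj => /=.
  have [/eqP ji0|gt0] := posnP (j - i)%N.
    by apply/eqP; rewrite eqn_leq le_ij.
  have := leq_trans (dvdn_leq gt0 dvd_ji) (leq_subr i j).
  by rewrite leqNgt ltn_ord.
have [|f _ fK] := inj_card_bij nat_inj; first by rewrite card_ord.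
by exists (f x); rewrite fK.
Qed.

Definition translation (b : F) : {perm F} := perm (@addIr F b).

Lemma translationE b x : translation b x = (x + b)%R.
Proof. by rewrite permE. Qed.

(* The scope annotation matters: in group_scope, 1 : F is the additive unit. *)
Lemma translationX n x : (translation 1%R ^+ n) x = (x + n%:R)%R.
Proof.
elim: n => [|n IH]; first by rewrite perm1 addr0.
by rewrite expgSr permM IH translationE -addrA natr1.
Qed.

Lemma order_translation : #[translation 1%R] = #|F|.
Proof.
apply: nt_prime_order => //.
  apply/permP => x.
  by rewrite translationX (pcharf0 pchar_prime_card) addr0 perm1.
apply/eqP => /permP/(_ 0%R); rewrite translationE perm1 add0r.
exact/eqP/oner_neq0.
Qed.

(** A connection set made of units rules out loops and lets the multiplicative group act on it by
    cosets. *)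
Definition circulant (C : {set {unit F}}) : digraph F :=
  [set e | [exists u in C, e.2 == e.1 + val u]%R].

Lemma circulantE C v u : ((v, v + val u)%R \in circulant C) = (u \in C).
Proof.
rewrite inE /=; apply/exists_inP/idP => [[w wC /eqP/addrI/val_inj->] //|uC].
by exists u.
Qed.

Lemma circulant_loop C v : (v, v) \notin circulant C.
Proof.
rewrite inE /=; apply/exists_inP => -[u _]; rewrite -subr_eq0 opprD addrA subrr.
by rewrite add0r oppr_eq0 -[_ == _]negbK -unitfE (valP u).
Qed.

Lemma neq_unitD (v w : F) : v != w -> exists u : {unit F}, w = (v + val u)%R.
Proof.
rewrite eq_sym -subr_eq0 -unitfE => Uwv; exists (FinRing.unit F Uwv).
by rewrite /= addrC subrK.
Qed.

(** An affine map multiplies every difference [w - v] by [a]. *)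
Lemma circulant_affine_iso (C : {set {unit F}}) (a : {unit F}) b
    (s : {perm F}) :
  (forall x, s x = x * val a + b)%R ->
  is_isomorphism (circulant C) (circulant (C :* a)) s.
Proof.
move=> sE; apply/is_isomorphismP => v w.
have [->|/neq_unitD[u ->]] := eqVneq v w.
  by rewrite !(negbTE (circulant_loop _ _)).
rewrite circulantE !sE mulrDl addrAC -FinRing.val_unitM circulantE.
by rewrite mem_rcoset mulgK.
Qed.

Lemma translation_Aut_circulant C b :
  translation b \in Aut_digraph (circulant C).
Proof.
rewrite inE; have := @circulant_affine_iso C 1 b (translation b).
by rewrite mulg1; apply=> x; rewrite translationE mulr1.
Qed.

Lemma minus_one_subproof : (-1)%R \is a @GRing.unit F.
Proof. by rewrite unitrN unitr1. Qed.

Definition minus_one : {unit F} := FinRing.unit F minus_one_subproof.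

Lemma val_mul_minus_one u : val (u * minus_one) = (- val u)%R.
Proof. by rewrite FinRing.val_unitM /= mulrN1. Qed.

Lemma order_minus_one : odd #|F| -> #[minus_one] = 2.
Proof.
move=> F_odd; apply: nt_prime_order => //.
  by apply: val_inj; rewrite FinRing.val_unitX /= sqrrN expr1n.
apply/eqP => /(congr1 val)/= /eqP; rewrite eq_sym -subr_eq0 opprK.
rewrite -[(1 + 1)%R]/(2%:R)%R -(dvdn_pcharf pchar_prime_card) => /dvdn_leq.
by move/(_ isT); move: F_odd (prime_gt1 p_pr); lia.
Qed.

Lemma circulant_tournament C : C \in halving_sets minus_one ->
  tournament (circulant C).
Proof.
move=> /halving_setsP CP; apply/andP; split.
  by apply/forallP => v; apply: circulant_loop.
apply/forallP => v; apply/forallP => w; apply/implyP => /neq_unitD[u ->].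
rewrite circulantE; have := circulantE C (v + val u)%R (u * minus_one).
by rewrite val_mul_minus_one addrK => ->; rewrite CP; case: (_ \in C).
Qed.

Lemma circulant_vt C : C \in halving_sets minus_one ->
  circulant C \in vt_tournaments F.
Proof.
move=> CX; rewrite inE circulant_tournament //=.
apply/imsetP; exists 0%R => //; apply/esym/setP => x; rewrite [RHS]inE.
apply/imsetP; exists (translation x); first exact: translation_Aut_circulant.
by rewrite /= apermE translationE add0r.
Qed.

(** Invariance under all translations makes an arc depend only on the difference of its ends, so [C]
    is read off as the out-neighbours of 0. *)
Lemma translation_tournament G :
  tournament G -> translation 1%R \in Aut_digraph G ->
  exists2 C, C \in halving_sets minus_one & G = circulant C.
Proof.
move=> /andP[/forallP Gl /forallP Gt] tG.
have GE b v w : ((v + b, w + b)%R \in G) = ((v, w) \in G).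
  have [n ->] := natr_surj b.
  have : translation 1%R ^+ n \in Aut_digraph G by apply: groupX.
  by rewrite inE => /is_isomorphismP tn; rewrite [RHS]tn !translationX.
pose C := [set u : {unit F} | (0%R, val u) \in G].
exists C.
  rewrite inE; apply/forallP => u; rewrite ![_ \in C]inE val_mul_minus_one.
  rewrite -(GE (val u) _ (- _)%R) add0r addNr.
  apply: (implyP (forallP (Gt 0%R) (val u))).
  by have := valP u; rewrite unitfE eq_sym.
apply/setP => -[v w]; have [->|/neq_unitD[u ->]] := eqVneq v w.
  by rewrite (negbTE (circulant_loop _ _)) (negbTE (Gl w)).
by rewrite circulantE inE -(GE v 0%R) add0r addrC.
Qed.

Lemma vt_circulant G : G \in vt_tournaments F ->
  exists2 C, C \in halving_sets minus_one & isomorphic G (circulant C).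
Proof.
rewrite inE => /andP[Gt Gvt].
(* Transitivity makes p divide the order of the automorphism group. *)
have /Cauchy[//|x xG ox] : #|F| %| #|Aut_digraph_group G|.
  by rewrite -cardsT; apply: atrans_dvd Gvt.
(* Conjugating in the full symmetric group relabels the vertices so that [<[x]>] becomes the group
   of translations. *)
have [s _ xs] := cycle_conj_prime p_pr ox order_translation
                                  (in_setT x) (in_setT _).
have GH := digraph_imageP G s.
have [|C CX GC] := translation_tournament (isomorphism_tournament GH Gt).
  have : <[x ^ s]> \subset Aut_digraph_group (digraph_image G s).
    by rewrite cycle_subG; apply: isomorphism_conj_Aut GH xG.
  by rewrite -xs cycle_subG.
by exists C => //; rewrite -GC; apply/existsP; exists s.
Qed.

(** If [s] conjugates translation by 1 to translation by n, then [s (x + 1) = s x + n]. Injectivity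
    of [s] makes n nonzero. *)
Lemma normal_translation_affine s :
  translation 1%R ^ s \in <[translation 1%R]> ->
  exists a : {unit F}, forall x, (s x = x * val a + s 0)%R.
Proof.
move=> /cycleP[n sE].
have step x : (s (x + 1) = s x + n%:R)%R.
  by rewrite -translationX -sE permJ translationE.
have affine x : (s x = x * n%:R + s 0)%R.
  have [k ->] := natr_surj x; elim: k => [|k IH]; first by rewrite mul0r add0r.
  by rewrite -natr1 step IH mulrDl mul1r addrAC.
have Un : n%:R%R \is a @GRing.unit F.
  rewrite unitfE; apply/eqP => n0; have := affine 1%R.
  by rewrite n0 mulr0 add0r => /perm_inj/eqP; rewrite oner_eq0.
by exists (FinRing.unit F Un).
Qed.

Lemma circulant_isomorphicP C D :
  reflect (exists a, D = C :* a) (isomorphic (circulant C) (circulant D)).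
Proof.
apply: (iffP existsP) => [[s CD]|[a ->]]; last first.
  exists (perm (mulIr (valP a))); apply: (@circulant_affine_iso _ _ 0) => x.
  by rewrite permE addr0.
have tD := translation_Aut_circulant D 1%R.
(* The translations and their conjugate by [s] both lie in the automorphism group of [circulant D].
   Correcting [s] by an automorphism [h] makes it normalize the translations, hence affine. *)
have [|h hD tsh] := cycle_conj_prime (A := Aut_digraph_group (circulant D)) p_pr
  _ order_translation
  (isomorphism_conj_Aut CD (translation_Aut_circulant C 1%R)) tD.
  by rewrite orderJ order_translation.
have [|a aE] := @normal_translation_affine (s * h).
  by rewrite conjgM tsh cycle_id.
have /is_isomorphismP CDh : is_isomorphism (circulant C) (circulant D) (s * h).
  move: CD hD; rewrite inE => /is_isomorphismP sE /is_isomorphismP hE.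
  by apply/is_isomorphismP => v w; rewrite sE hE !permM.
have /is_isomorphismP CCa := circulant_affine_iso C aE.
(* [circulant D] and [circulant (C :* a)] are both the image of [circulant C] under [s * h], so they
   have the same arcs out of 0. *)
exists a; apply/setP => u.
rewrite -(circulantE D 0%R) -(circulantE (C :* a) 0%R).
rewrite -(permKV (s * h) 0%R) -(permKV (s * h) (_ + _)%R).
by rewrite -CDh -CCa.
Qed.

Lemma card_vt_tournament_classes :
  #|vt_tournament_classes F|
    = #|orbit 'Rs [set: {unit F}] @: halving_sets minus_one|.
Proof.
have isoE := @isomorphic_equiv F.
pose cls G := [set H in vt_tournaments F | isomorphic G H].
(* Every class contains a circulant, so classes can be indexed by halving sets; it remains to see
   that two sets give one class exactly when they share an orbit. *)
transitivity #|[set cls (circulant C) | C in halving_sets minus_one]|.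
  congr #|pred_of_set _|; apply/setP => B; apply/imsetP/imsetP => -[].
    move=> G GV ->; have [C CX GC] := vt_circulant GV; exists C => //.
    by apply/setP => H; rewrite !inE; congr (_ && _); apply: (isoE _ _ _).2.
  by move=> C CX ->; exists (circulant C) => //; apply: circulant_vt.
apply: card_imset_fibers => C D CX DX; split=> [/orbit_eqP|].
  case/imsetP=> a _ ->; rewrite /= rcosetE.
  have iso : isomorphic (circulant D) (circulant (D :* a)).
    by apply/circulant_isomorphicP; exists a.
  apply/setP => H; rewrite !inE; congr (_ && _).
  by rewrite ((isoE _ _ _).2 iso).
move=> /setP/(_ (circulant D)).
rewrite ![_ \in [set _ in _ | _]]inE circulant_vt //=.
rewrite (isoE (circulant D) (circulant D) (circulant D)).1.
case/circulant_isomorphicP=> a ->.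
by apply/esym/orbit_eqP/imsetP; exists a; rewrite ?inE //= rcosetE.
Qed.

Lemma card_vt_tournament_classes_prime (e r : nat) :
    odd #|F| -> 0 < e -> odd r -> #|F|.-1 = (2 ^ e * r)%N ->
  (#|vt_tournament_classes F|%:R
     = \sum_(1 <= m < r.+1 | (m %| r)%N) k_ #|F| r m :> rat)%R.
Proof.
move=> F_odd e_gt0 r_odd FE; rewrite card_vt_tournament_classes.
have cardU := card_finField_unit F.
have /cyclicP[g gE] := field_unit_group_cyclic [set: {unit F}]%G.
apply: (card_halving_orbits (esym gE) (order_minus_one F_odd) _ e_gt0) => //.
by rewrite cardU.
Qed.

End Circulants.

(** * Specialization to ['F_p] and transfer to ['I_p] *)

Local Open Scope ring_scope.

Theorem theorem4p1p3 (p e r : nat) (p_prime : prime p) (p_odd : odd p)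
    (e_ge1 : (1 <= e)%N) (r_odd : odd r) (pE : (p - 1 = 2 ^ e * r)%N) :
  #|vt_tournament_classes 'I_p|%:R
    = \sum_(1 <= m < r.+1 | (m %| r)%N) k_ p r m :> rat.
Proof.
have cardF := card_Fp p_prime.
(* ['F_p] is itself an ordinal type, whose bound [Fp_cast] rewrites to [p] for prime [p]. *)
have -> : #|vt_tournament_classes 'I_p| = #|vt_tournament_classes 'F_p|.
  by rewrite Fp_cast.
rewrite -[in RHS]cardF.
apply: (@card_vt_tournament_classes_prime 'F_p _ e) => //.
- by rewrite cardF.
- by rewrite cardF.
- by rewrite cardF -subn1.
Qed.
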